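(* Let $W=(w_i)_{i\geq 1}$ be the infinite word over $\{1,2\}$ and $\theta=\sum_{i=1}^{\infty} w_iT^{-i}\in \mathbb{Q}((T^{-1}))$ its generating function, as defined in the context. Then $\theta$ is an irrational element of $\mathbb{Q}((T^{-1}))$ (that is, $\theta\notin\mathbb{Q}(T)$), which can be expanded as an infinite continued fraction $$\theta=[0,a_1,a_2,\dots,a_n,\dots],$$ where the partial quotients $a_n\in \mathbb{Q}[T]$ ($n\geq 1$) are non-constant polynomials, given explicitly as follows. The first four partial quotients are $$(a_1,a_2,a_3,a_4)=\left(T-2,\ \frac{T}{2}+\frac14,\ \frac{8T}{5}+\frac{76}{25},\ -\frac{125T}{48}+\frac{25}{24}\right).$$ Define the sequence of integers $(\ell_n)_{n\geq 0}$ by $\ell_0=0$, $\ell_1=1$ and $\ell_{n+1}=2\ell_n+\ell_{n-1}+2$ for $n\geq 1$. For $n\geq 1$ define the rational numbers $$r_n=\frac{4}{25}\,(2\ell_n-\ell_{n-1}+1),\qquad s_n=r_{n+1}+r_n,$$ and $$\lambda_{4n+1}=(-1)^{n+1}r_n^2,\qquad \lambda_{4n+2}=(-1)^{n+1}(r_ns_n)^{-1},$$ $$\lambda_{4n+3}=(-1)^{n+1}s_n^2,\qquad \lambda_{4n+4}=(-1)^{n+1}(r_{n+1}s_n)^{-1}.$$ For $n\geq 1$ define the polynomials $A_n,B_n\in\mathbb{Q}[T]$ by $$A_n=\frac{T^{(3\ell_n+\ell_{n-1}+3)/2}+T^{(\ell_n+\ell_{n-1}+1)/2}-2}{T-1},\qquad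 B_n=\frac{T^{(\ell_n+\ell_{n-1}+3)/2}-1}{T-1}.$$ Then for every $n\geq 1$, $$(a_{4n+1},a_{4n+2},a_{4n+3},a_{4n+4})=\bigl(\lambda_{4n+1}A_n,\ \lambda_{4n+2}(T-1),\ \lambda_{4n+3}B_n,\ \lambda_{4n+4}(T-1)\bigr).$$
   Context: Finite words $(W_n)_{n\geq 0}$ over the alphabet $\{1,2\}$ are defined recursively by $W_0=\emptyset$ (the empty word), $W_1=1$, and, for $n\geq 2$, $W_n=W_{n-1},2,W_{n-2},2,W_{n-1}$ (concatenation of words and letters). For $n\geq 1$, $W_{n-1}$ is a prefix of $W_n$, and $W=(w_i)_{i\geq 1}$ denotes the infinite word that begins with $W_n$ for all $n\geq 0$; thus $W=122121212212\dots$. The integer $\ell_n$ appearing in the claim is the length of $W_n$. $\mathbb{Q}((T^{-1}))$ is the field of formal Laurent series in $T^{-1}$ over $\mathbb{Q}$ (series $\sum_{k\leq k_0}c_kT^k$ with $c_k\in\mathbb{Q}$), which contains $\mathbb{Q}(T)$ and is complete for the absolute value determined by the degree in $T$. For polynomials $a_1,a_2,\dots\in\mathbb{Q}[T]$ of positive degree, $$[0,a_1,a_2,\dots,a_n]=\cfrac{1}{a_1+\cfrac{1}{a_2+\cfrac{1}{\ddots+\cfrac{1}{a_n}}}}\in\mathbb{Q}(T),$$ and $[0,a_1,a_2,\dots,a_n,\dots]$ denotes the limit of these elements in $\mathbb{Q}((T^{-1}))$ as $n\to\infty$. Every irrational element of $\mathbb{Q}((T^{-1}))$ has a unique infinite continued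 fraction expansion $[a_0,a_1,a_2,\dots]$ with $a_0\in\mathbb{Q}[T]$ and $a_n\in\mathbb{Q}[T]$ non-constant for $n\geq 1$; the $a_n$ are called the partial quotients. *)

(* Defs.v *)
From HB Require Import structures.
From mathcomp Require Import all_boot all_order all_algebra.
From mathcomp Require Import mathcomp_extra boolp classical_sets functions.
From mathcomp Require Import cardinality fsbigop.
From mathcomp Require Import zify.
Set Implicit Arguments.
Unset Strict Implicit.
Unset Printing Implicit Defensive.
Import Order.TTheory GRing.Theory Num.Theory.
Local Open Scope classical_set_scope.
Local Open Scope ring_scope.

(** The field K((T^-1)): [f k] is the coefficient of T^k, and it vanishes for
    all large enough k. *)

Section Laurent.
Variable K : fieldType.

Record laurent := Laurent {
  lcoef :> int -> K;
  lcoef_bounded : exists N : int, forall k, N < k -> lcoef k = 0 }.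

HB.instance Definition _ := gen_eqMixin laurent.
HB.instance Definition _ := gen_choiceMixin laurent.

Implicit Types (f g h : laurent) (M N P k : int) (n m : nat).

Lemma laurentP f g : (forall k, f k = g k) -> f = g.
Proof.
case: f => f Pf; case: g => g Pg /= /funext fg; subst g.
by congr Laurent; exact: Prop_irrelevance.
Qed.

Definition lbound f N := forall k, N < k -> f k = 0.

Lemma lzero_subproof : exists N : int, forall k, N < k -> (0 : K) = 0.
Proof. by exists 0. Qed.
Definition lzero := Laurent lzero_subproof.

Lemma lone_subproof :
  exists N : int, forall k, N < k -> (if k == 0 then 1 else 0 : K) = 0.
Proof. by exists 0 => k; case: eqP => // ->; rewrite ltxx. Qed.
Definition lone := Laurent lone_subproof.

Lemma lopp_subproof f : exists N : int, forall k, N < k -> - f k = 0.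
Proof. by case: f => f [N fN]; exists N => k /fN /= ->; rewrite oppr0. Qed.
Definition lopp f := Laurent (lopp_subproof f).

Lemma ladd_subproof f g : exists N : int, forall k, N < k -> f k + g k = 0.
Proof.
case: f g => f [M fM] [g [N gN]]; exists (Num.max M N) => k /=.
by rewrite gt_max => /andP[/fM -> /gN ->]; rewrite addr0.
Qed.
Definition ladd f g := Laurent (ladd_subproof f g).

(* Only finitely many terms of the convolution sum are nonzero. *)
Definition lconv f g k : K := \sum_(i \in [set: int]) (f i * g (k - i)).

Lemma lconv_bound f g M N : lbound f M -> lbound g N ->
  forall k, M + N < k -> lconv f g k = 0.
Proof.
move=> fM gN k MNk; apply: fsbig1 => i _.
have [Mi|iM] := ltP M i; first by rewrite fM ?mul0r.
by rewrite gN ?mulr0 //; lia.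
Qed.

Lemma lmul_subproof f g :
  exists N : int, forall k, N < k -> lconv f g k = 0.
Proof.
by case: (lcoef_bounded f) (lcoef_bounded g) => M fM [N gN];
  exists (M + N); apply: lconv_bound.
Qed.
Definition lmul f g := Laurent (lmul_subproof f g).

Lemma fsum_window (F : int -> K) (h : nat -> int) n : injective h ->
  (forall i, F i != 0 -> exists2 j : nat, (j < n)%N & i = h j) ->
  \sum_(i \in [set: int]) F i = \sum_(j < n) F (h j).
Proof.
move=> hI FP; rewrite (fsbig_ord _ n (fun j => F (h j))) -(fsbig_image `I_n h F);
    last first.
  by move=> x y _ _ /hI.
apply/esym/fsbig_widen => // i [_ /= ni].
apply: contrapT => /eqP/FP[j jn ij]; apply: ni; exists j => //.
Qed.

Let tr m M f : {poly K} := \poly_(i < m) f (M - i%:Z).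

Lemma lmul_coef f g M N n m : lbound f M -> lbound g N -> (n < m)%N ->
  lmul f g (M + N - n%:Z) = (tr m M f * tr m N g)`_n.
Proof.
move=> fM gN nm; rewrite /= /lconv (@fsum_window _ (fun j => M - j%:Z) n.+1).
- rewrite coefM; apply: eq_bigr => j _; rewrite !coef_poly.
  rewrite (leq_ltn_trans _ nm) ?(leq_ltn_trans _ nm) ?leq_subr //; last first.
    by rewrite -ltnS.
  by congr (_ * g _); have := ltn_ord j; lia.
- by move=> i j; lia.
- move=> i; have [Mi|iM] := ltP M i; first by rewrite fM ?mul0r ?eqxx.
  have [Ni|iN] := ltP N (M + N - n%:Z - i).
    by rewrite gN ?mulr0 ?eqxx //.
  by move=> _; exists `|M - i|%N; lia.
Qed.

Lemma laurent_eq_bound f g M : lbound f M -> lbound g M ->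
  (forall n, f (M - n%:Z) = g (M - n%:Z)) -> f = g.
Proof.
move=> fM gM fg; apply: laurentP => k.
have [Mk|kM] := ltP M k; first by rewrite fM ?gM.
by have -> : k = M - `|M - k|%N%:Z by lia.
Qed.

Lemma lmul_bound f g M N : lbound f M -> lbound g N -> lbound (lmul f g) (M + N).
Proof. exact: lconv_bound. Qed.

Lemma tr_lmul f g M N n m : lbound f M -> lbound g N -> (n < m)%N ->
  (tr m (M + N) (lmul f g))`_n = (tr m M f * tr m N g)`_n.
Proof. by move=> fM gN nm; rewrite coef_poly nm (lmul_coef (m := m)). Qed.

Lemma coefM_congr (p q q' : {poly K}) n :
  (forall i, (i <= n)%N -> q`_i = q'`_i) -> (p * q)`_n = (p * q')`_n.
Proof.
by move=> qq'; rewrite !coefM; apply: eq_bigr => i _; rewrite qq' ?leq_subr.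
Qed.

Lemma laddA : associative ladd.
Proof. by move=> f g h; apply: laurentP => k; exact: addrA. Qed.
Lemma laddC : commutative ladd.
Proof. by move=> f g; apply: laurentP => k; exact: addrC. Qed.
Lemma ladd0 : left_id lzero ladd.
Proof. by move=> f; apply: laurentP => k; exact: add0r. Qed.
Lemma laddN : left_inverse lzero lopp ladd.
Proof. by move=> f; apply: laurentP => k; exact: addNr. Qed.

HB.instance Definition _ := GRing.isZmodule.Build laurent laddA laddC ladd0 laddN.

Lemma lmulC : commutative lmul.
Proof.
move=> f g; case: (lcoef_bounded f) (lcoef_bounded g) => M fM [N gN].
apply: (@laurent_eq_bound _ _ (M + N)) => [||n].
- exact: lmul_bound.
- by rewrite addrC; apply: lmul_bound.
- by rewrite (lmul_coef fM gN (ltnSn n)) mulrC (addrC M) (lmul_coef gN fM (ltnSn n)).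
Qed.

Lemma lmulA : associative lmul.
Proof.
move=> f g h.
have [[M fM] [N gN] [P hP]] :=
  And3 (lcoef_bounded f) (lcoef_bounded g) (lcoef_bounded h).
have gh := lmul_bound gN hP; have fg := lmul_bound fM gN.
apply: (@laurent_eq_bound _ _ (M + (N + P))) => [||n].
- exact: lmul_bound.
- by rewrite addrA; apply: lmul_bound.
- rewrite (lmul_coef fM gh (ltnSn n)) addrA (lmul_coef fg hP (ltnSn n)).
  rewrite [in RHS]mulrC.
  rewrite (@coefM_congr _ _ (tr n.+1 N g * tr n.+1 P h)); last first.
    by move=> i ni; rewrite tr_lmul.
  rewrite [RHS](@coefM_congr _ _ (tr n.+1 M f * tr n.+1 N g)); last first.
    by move=> i ni; rewrite tr_lmul.
  by rewrite mulrA [in RHS]mulrC.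
Qed.

Lemma lmul1 : left_id lone lmul.
Proof.
move=> f; apply: laurentP => k /=.
rewrite /lconv (@fsum_window _ (fun j : nat => j%:Z) 1).
- by rewrite big_ord1 /= mul1r subr0.
- by move=> i j [].
- by move=> i /=; case: (i =P 0) => [->|_]; [exists 0%N|rewrite mul0r eqxx].
Qed.

Lemma lmulD : left_distributive lmul ladd.
Proof.
move=> f g h.
have [[M fM] [N gN] [P hP]] :=
  And3 (lcoef_bounded f) (lcoef_bounded g) (lcoef_bounded h).
pose B := Num.max M N.
have fB : lbound f B by move=> k; rewrite gt_max => /andP[/fM].
have gB : lbound g B by move=> k; rewrite gt_max => /andP[_ /gN].
have fgB : lbound (ladd f g) B.
  by move=> k Bk /=; rewrite fB // gB // addr0.
apply: (@laurent_eq_bound _ _ (B + P)) => [||n].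
- exact: lmul_bound.
- move=> k Bk; rewrite [LHS]/=.
  by rewrite (lconv_bound fB hP Bk) (lconv_bound gB hP Bk) addr0.
- rewrite (lmul_coef fgB hP (ltnSn n)).
  rewrite -[RHS]/(lmul f h (B + P - n%:Z) + lmul g h (B + P - n%:Z)).
  rewrite (lmul_coef fB hP (ltnSn n)) (lmul_coef gB hP (ltnSn n)).
  rewrite -coefD -mulrDl; congr (nth 0 (polyseq (_ * _)) n).
  by apply/polyP => i; rewrite coefD !coef_poly; case: ifP => //; rewrite addr0.
Qed.

Lemma lone_neq0 : lone != lzero.
Proof.
by apply/eqP => /(congr1 (fun f : laurent => f 0)) /= /eqP; rewrite oner_eq0.
Qed.

HB.instance Definition _ :=
  GRing.Zmodule_isComNzRing.Build laurent lmulA lmulC lmul1 lmulD lone_neq0.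

Definition is_ldeg f k := f k != 0 /\ lbound f k.

Lemma ldeg_exists f : f != 0 -> exists k, is_ldeg f k.
Proof.
move=> f0; have [M fM] := lcoef_bounded f.
have exn : exists n, f (M - n%:Z) != 0.
  apply: contrapT => nex; case/eqP: f0.
  apply: (laurent_eq_bound (M := M)) => // n.
  by apply/eqP/negPn/negP => fn; apply: nex; exists n.
case: (ex_minnP exn) => n fn nmin; exists (M - n%:Z); split=> // k nk.
have [Mk|kM] := ltP M k; first exact: fM.
apply/eqP/negPn/negP => fk.
have /nmin : f (M - `|M - k|%N%:Z) != 0 by have -> : M - `|M - k|%N%:Z = k by lia.
by lia.
Qed.

Section Inverse.
Variable F : nat -> K.
Let next n (s : seq K) : K :=
  (F 0)^-1 * ((n == 0%N)%:R - \sum_(i < n) F i.+1 * s`_(n.-1 - i)).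
Fixpoint lrecip_seq n : seq K :=
  if n is n'.+1 then rcons (lrecip_seq n') (next n' (lrecip_seq n')) else [::].
Definition lrecip n := next n (lrecip_seq n).

Lemma size_lrecip_seq n : size (lrecip_seq n) = n.
Proof. by elim: n => //= n IH; rewrite size_rcons IH. Qed.

Lemma nth_lrecip_seq n i : (i < n)%N -> (lrecip_seq n)`_i = lrecip i.
Proof.
elim: n => //= n IH; rewrite ltnS leq_eqVlt nth_rcons size_lrecip_seq.
by case: ltngtP => //= [/IH //|->].
Qed.

Lemma lrecipP n : F 0 != 0 ->
  \sum_(i < n.+1) F i * lrecip (n - i) = (n == 0%N)%:R.
Proof.
move=> F0; rewrite big_ord_recl subn0 {1}/lrecip /next mulrA mulfV // mul1r.
rewrite -addrA -[RHS]addr0; congr (_ + _); apply/eqP; rewrite addrC subr_eq0.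
apply/eqP/eq_bigr => i _; rewrite nth_lrecip_seq; last by have := ltn_ord i; lia.
by congr (_ * lrecip _); rewrite /= /bump; lia.
Qed.
End Inverse.

Lemma lrecip_exists f : f != 0 -> exists g, g * f = 1.
Proof.
move=> /ldeg_exists[d [fd fdb]].
pose F (n : nat) := f (d - n%:Z).
have F0 : F 0%N != 0 by rewrite /F subr0.
have gP : exists N : int, forall k, N < k ->
    (if k <= - d then lrecip F `|- d - k|%N else 0) = 0.
  by exists (- d) => k; case: leP.
pose g := Laurent gP; exists g.
have gd : lbound g (- d) by move=> k /=; case: leP.
rewrite mulrC; apply: (@laurent_eq_bound _ _ (d - d)) => [||n].
- exact: lmul_bound.
- by move=> k; rewrite subrr /=; case: eqP => // ->.
- rewrite (lmul_coef fdb gd (ltnSn n)) coefM.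
  have -> : (1 : laurent) (d - d - n%:Z) = (n == 0%N)%:R.
    by rewrite subrr sub0r /= oppr_eq0; case: n.
  rewrite -(lrecipP n F0); apply: eq_bigr => i _; rewrite !coef_poly.
  rewrite ltn_ord ltnS leq_subr /= ifT; last by lia.
  by congr (_ * lrecip F _); lia.
Qed.

Definition linv f : laurent := xget 0 [set g | g * f = 1].

Lemma lmulV f : f != 0 -> linv f * f = 1.
Proof. by move=> /lrecip_exists /(xgetPex 0). Qed.

Lemma linv0 : linv 0 = 0.
Proof.
apply: xgetPN => g /=; rewrite mulr0 => /eqP.
by rewrite eq_sym oner_eq0.
Qed.

HB.instance Definition _ := GRing.ComNzRing_isField.Build laurent lmulV linv0.

(** The embedding of K[T]; K(T) is the subfield of quotients of polynomials. *)

Lemma lpoly_subproof (p : {poly K}) : exists N : int, forall k, N < k ->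
  (if k is Posz n then p`_n else 0) = 0.
Proof.
exists (size p)%:Z => -[n|//]; rewrite ltz_nat => /ltnW.
exact: nth_default.
Qed.
Definition lpoly (p : {poly K}) := Laurent (lpoly_subproof p).

Lemma lpoly_is_zmod_morphism : zmod_morphism lpoly.
Proof.
move=> p q; apply: laurentP => -[n|n] /=; first by rewrite coefB.
by rewrite subrr.
Qed.

Lemma lpoly_is_monoid_morphism : monoid_morphism lpoly.
Proof.
split; first by apply: laurentP => -[[|n]|n] /=; rewrite ?coef1.
move=> p q; apply: laurentP => -[n|n].
- rewrite [LHS]/= coefM [RHS]/= /lconv.
  rewrite (@fsum_window _ (fun j : nat => j%:Z) n.+1).
  + apply: eq_bigr => i _.
    by have -> : n%:Z - i%:Z = (n - i)%N%:Z by have := ltn_ord i; lia.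
  + by move=> i j [].
  + move=> [i|i] /=; last by rewrite mul0r eqxx.
    have [ni|ni] := ltnP i n.+1; first by exists i.
    have -> : n%:Z - i%:Z = Negz (i - n).-1 by lia.
    by rewrite mulr0 eqxx.
- apply/esym/fsbig1 => -[i|i] _ /=; last by rewrite mul0r.
  have -> : Negz n - i%:Z = Negz (n + i) by lia.
  by rewrite mulr0.
Qed.

HB.instance Definition _ :=
  GRing.isZmodMorphism.Build {poly K} laurent lpoly lpoly_is_zmod_morphism.
HB.instance Definition _ :=
  GRing.isMonoidMorphism.Build {poly K} laurent lpoly lpoly_is_monoid_morphism.

Lemma lpoly_inj : injective lpoly.
Proof.
move=> p q pq; apply/polyP => n.
exact: (congr1 (fun f : laurent => f n%:Z) pq).
Qed.

Definition is_ratfun f : Prop :=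
  exists p q : {poly K}, q != 0 /\ f = lpoly p / lpoly q.

(** The absolute value |f| = 2 ^ deg f, and convergence for it; replacing 2 by
    another real number > 1 does not change the topology. *)

Definition ldeg f : int := xget 0 [set k | is_ldeg f k].

Definition labs f : rat := if f == 0 then 0 else 2%:Q ^ ldeg f.

Definition lcvg (u : nat -> laurent) (l : laurent) : Prop :=
  forall e : rat, 0 < e ->
    exists n0 : nat, forall n, (n0 <= n)%N -> labs (u n - l) < e.

Lemma ldegP f : f != 0 -> is_ldeg f (ldeg f).
Proof. by move=> /ldeg_exists /(xgetPex 0). Qed.

(* cfrac a n = [a 0, a 1, ..., a n] *)
Fixpoint cfrac (a : nat -> {poly K}) n : laurent :=
  if n is n'.+1 then lpoly (a 0%N) + (cfrac (fun i => a i.+1) n')^-1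
  else lpoly (a 0%N).

Definition is_cfrac_expansion (a : nat -> {poly K}) f : Prop :=
  (forall n, (1 <= n)%N -> (1 < size (a n))%N) /\ lcvg (cfrac a) f.

End Laurent.

(** The words W_n and the infinite word W = (w_i)_(i >= 1). *)

Fixpoint word n : seq nat :=
  if n is n'.+1 then
    if n' is n''.+1 then word n' ++ 2%N :: word n'' ++ 2%N :: word n'
    else [:: 1%N]
  else [::].

Fixpoint ell n : nat :=
  if n is n'.+1 then
    if n' is n''.+1 then (2 * ell n' + ell n'' + 2)%N else 1%N
  else 0%N.

Arguments word !n : simpl nomatch.
Arguments ell !n : simpl nomatch.

Lemma wordSS n : word n.+2 = word n.+1 ++ 2%N :: word n ++ 2%N :: word n.+1.
Proof. by []. Qed.

Lemma ellSS n : ell n.+2 = (2 * ell n.+1 + ell n + 2)%N.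
Proof. by []. Qed.

Lemma size_word n : size (word n) = ell n.
Proof.
suff [] : size (word n) = ell n /\ size (word n.+1) = ell n.+1 by [].
elim: n => [//|n [IH1 IH2]]; split=> //.
by rewrite wordSS ellSS size_cat /= size_cat /= IH1 IH2; lia.
Qed.

Lemma leq_ell n : (n <= ell n)%N.
Proof.
suff /andP[] : (n <= ell n)%N && (n.+1 <= ell n.+1)%N by [].
elim: n => [//|n /andP[IH1 IH2]]; rewrite IH2 ellSS. lia.
Qed.

(* W_i has at least i letters, so the i-th letter can be read off there. *)
Definition w (i : nat) : nat := nth 0%N (word i) i.-1.

Lemma word_prefix m n : (m <= n)%N -> prefix (word m) (word n).
Proof.
elim: n => [|n IH]; first by case: m.
rewrite leq_eqVlt => /orP[/eqP->|]; first exact: prefix_refl.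
rewrite ltnS => /IH mn; apply: prefix_trans mn _.
by case: n {IH} => // n; rewrite wordSS prefix_prefix.
Qed.

Lemma w_word n i : (1 <= i <= ell n)%N -> w i = nth 0%N (word n) i.-1.
Proof.
case/andP=> i0 iln; have ii := leq_ell i; rewrite /w.
case: (leqP i n) => [/word_prefix|/ltnW/word_prefix] /prefixP[s ->].
- by rewrite nth_cat size_word ifT //; lia.
- by rewrite nth_cat size_word ifT //; lia.
Qed.

Lemma theta_subproof : exists N : int, forall k : int, N < k ->
  (if k is Negz i then (w i.+1)%:R else 0 : rat) = 0.
Proof. by exists 0 => -[]. Qed.

(* [Negz i] is the integer -(i+1). *)
Definition theta : laurent rat := Laurent theta_subproof.

(** The data of the partial quotients; in these definitions n >= 1. *)

Definition r (n : nat) : rat :=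
  4 / 25 * (2 * (ell n)%:R - (ell n.-1)%:R + 1).

Definition s (n : nat) : rat := r n.+1 + r n.

Definition A (n : nat) : {poly rat} :=
  ('X^((3 * ell n + ell n.-1 + 3) %/ 2) + 'X^((ell n + ell n.-1 + 1) %/ 2) - 2)
    %/ ('X - 1).

Definition B (n : nat) : {poly rat} :=
  ('X^((ell n + ell n.-1 + 3) %/ 2) - 1) %/ ('X - 1).

(* All the divisions in the exponents and of the polynomials are exact. *)
Lemma odd_ell n : (1 <= n)%N -> odd (ell n + ell n.-1).
Proof.
case: n => // n _; elim: n => [//|n IH].
by move: IH; rewrite /= ?ellSS; lia.
Qed.

Lemma exponents_exact n : (1 <= n)%N ->
  [/\ 2 %| 3 * ell n + ell n.-1 + 3, 2 %| ell n + ell n.-1 + 1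
    & 2 %| ell n + ell n.-1 + 3]%N.
Proof. by move=> /odd_ell; split; lia. Qed.

Lemma A_exact n : A n * ('X - 1) =
  'X^((3 * ell n + ell n.-1 + 3) %/ 2) + 'X^((ell n + ell n.-1 + 1) %/ 2) - 2.
Proof.
rewrite divpK // -(polyC1 rat) dvdp_XsubCl rootE -[2]/(2%:R) -polyC_natr.
by rewrite !hornerE !expr1n.
Qed.

Lemma B_exact n :
  B n * ('X - 1) = 'X^((ell n + ell n.-1 + 3) %/ 2) - 1.
Proof.
by rewrite divpK // -(polyC1 rat) dvdp_XsubCl rootE !hornerE expr1n subrr.
Qed.

(* Main.v *)
Require Import Defs.
From mathcomp Require Import all_boot all_order all_algebra.
From mathcomp Require Import zify ring lra.
Import Order.TTheory GRing.Theory Num.Theory.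
Local Open Scope ring_scope.

(** Let x_n be the word W_n followed by the letter 2, so that
    x_(n+1) = x_n x_(n-1) x_n, let X_n be the polynomial with the letters of
    x_n as coefficients, L_n = ell_n + 1 its length and
    e_n = (L_n + L_(n-1) + 1) / 2.

    The infinite word begins with x_(n+1) x_n, hence theta is close to the
    purely periodic series with this period, that is to C_n / (T^N - 1) where
    N = L_(n+1) + L_n and C_n is the polynomial of x_(n+1) x_n.  These
    fractions are, for n >= 1, the convergents of index 4n+2 of the claimed
    expansion, with the common factor -1/s_n in numerator and denominator.  The
    convergents of index 4n come from eventually periodic words: up to the
    factor -1/r_n, their denominator is T^(e_(n+1)) - T^(e_n) and their
    numerator is D_n = T^(e_n) X_n - (-1)^n (T - 1).

    Both the numerators and the denominators satisfy
      C_n     = (T^(e_(n+1) - 1) + T^(e_n - 1)) D_n + C_(n-1),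
      D_(n+1) = T^(e_n) C_n - D_n,
    lemmas [num_recurrence] and [den_recurrence].  For the numerators the
    first identity rests on the near-commutation of x_n and x_(n-1): the
    polynomials of x_n x_(n-1) and x_(n-1) x_n differ by
    (-1)^n T^(e_n - 1) (T - 1), lemma [X2_commutator].  The two multipliers
    are (T - 1) A_n + 2 and (T - 1) B_n + 1, and [block_step] shows that four
    steps of the continued fraction with the claimed partial quotients realise
    exactly these two identities.  An induction starting from the first four
    partial quotients then identifies the convergents of index 4n+2.

    For these indices q theta - p has negative degree, since C_n comes from a
    prefix of the word.  As consecutive convergents p_k / q_k differ by
    +-1 / (q_k q_(k+1)), such information for infinitely many indices forces
    all convergents to tend to theta with
    deg (theta - p_k / q_k) <= - deg q_k - deg q_(k+1)  ([cvt_error]),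
    which gives the expansion and excludes a rational theta. *)

Set Implicit Arguments.
Unset Strict Implicit.
Unset Printing Implicit Defensive.

(** * Degrees of Laurent series *)

Section LaurentDegree.
Variable K : fieldType.
Implicit Types (f g : laurent K) (p q : {poly K}) (M N : int).

Lemma lboundW f M N : M <= N -> lbound f M -> lbound f N.
Proof. by move=> MN fM k Nk; apply: fM; apply: le_lt_trans MN Nk. Qed.

Lemma lboundD f g N : lbound f N -> lbound g N -> lbound (f + g) N.
Proof. by move=> fN gN k Nk; rewrite [LHS]/= fN // gN // addr0. Qed.

Lemma lboundN f N : lbound f N -> lbound (- f) N.
Proof. by move=> fN k Nk; rewrite [LHS]/= fN // oppr0. Qed.

Lemma lcoefB f g k : (f - g) k = f k - g k.
Proof. by []. Qed.

Lemma lboundB f g N : lbound f N -> lbound g N -> lbound (f - g) N.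
Proof. by move=> fN gN; apply: lboundD => //; apply: lboundN. Qed.

Lemma lboundM f g M N : lbound f M -> lbound g N -> lbound (f * g) (M + N).
Proof. exact: lmul_bound. Qed.

Lemma lbound_lpoly p : lbound (lpoly p) ((size p)%:Z - 1).
Proof.
case=> [n|n] // pn; apply: nth_default.
by move: pn; move: (size p) => d; lia.
Qed.

Lemma is_ldeg_lpoly p : p != 0 -> is_ldeg (lpoly p) ((size p)%:Z - 1).
Proof.
move=> p0; split; last exact: lbound_lpoly.
have sp : (0 < size p)%N by rewrite size_poly_gt0.
have -> : (size p)%:Z - 1 = (size p).-1%:Z by lia.
by rewrite /= -lead_coefE lead_coef_eq0.
Qed.

Lemma is_ldegM f g M N : is_ldeg f M -> is_ldeg g N -> is_ldeg (f * g) (M + N).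
Proof.
move=> [f0 fM] [g0 gN]; split; last exact: lboundM.
have := lmul_coef fM gN (ltnSn 0); rewrite subr0 => ->.
by rewrite coef0M !coef_poly /= !subr0 mulf_neq0.
Qed.

Lemma lpoly_eq0 p : (lpoly p == 0) = (p == 0).
Proof. by rewrite -(rmorph0 (@lpoly K)) (inj_eq (@lpoly_inj K)). Qed.

(** The degrees of q and of 1/q add up to 0, the degree of 1. *)
Lemma lbound_lpolyV p : p != 0 -> lbound (lpoly p)^-1 (1 - (size p)%:Z).
Proof.
move=> p0; have lp0 : lpoly p != 0 by rewrite lpoly_eq0.
have Hp := is_ldeg_lpoly p0.
have : (lpoly p)^-1 != 0 by rewrite invr_eq0.
move=> /ldegP; set d := ldeg _ => Hd.
have [/eqP nz _] := is_ldegM Hp Hd; move: nz; rewrite mulfV //.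
have [dE _|//] := eqVneq ((size p)%:Z - 1 + d) 0.
  by apply: lboundW (proj2 Hd); move: dE; move: (size p) => m; lia.
by move=> dn; rewrite [X in X <> _]/= (negPf dn).
Qed.

Lemma lpoly_lbound_eq0 p : lbound (lpoly p) (-1) -> p = 0.
Proof.
by move=> pN; apply/polyP => n; rewrite coef0; apply: (pN n%:Z).
Qed.

Lemma labs_le f N : lbound f N -> labs f <= 2%:Q ^ N.
Proof.
move=> fN; rewrite /labs; case: eqP => [_|/eqP f0].
  by rewrite exprz_ge0.
rewrite ler_eXz2l // leNgt; apply/negP => /fN Hf.
by have [/eqP] := ldegP f0.
Qed.

Lemma lpoly_formZ (c p q : {poly K}) f :
  lpoly (c * q) * f - lpoly (c * p) = lpoly c * (lpoly q * f - lpoly p).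
Proof. by rewrite !rmorphM mulrBr mulrA. Qed.

Lemma lpolyXnM n f k : (lpoly 'X^n * f) k = f (k - n%:Z).
Proof.
rewrite [LHS]/= /lconv (@fsum_window _ _ (fun j => n%:Z + j%:Z) 1).
- by rewrite big_ord1 addr0 /= coefXn eqxx mul1r.
- by move=> i j; lia.
- move=> [i|i] /=; last by rewrite mul0r eqxx.
  rewrite coefXn; case: (i =P n) => [->|_]; last by rewrite mul0r eqxx.
  by exists 0%N; rewrite ?addr0.
Qed.

End LaurentDegree.

Lemma lcvg_lbound (K : fieldType) (u : nat -> laurent K) (l : laurent K) :
  (forall n, lbound (u n - l) (- n%:Z)) -> lcvg u l.
Proof.
move=> ul e e0; have /archi_boundP : 0 <= e^-1 by rewrite invr_ge0 ltW.
set m := Num.bound _ => em; exists m => n mn.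
apply: le_lt_trans (labs_le (ul n)) _.
rewrite -invr_expz -[ltRHS]invrK ltf_pV2 ?posrE ?invr_gt0 ?exprn_gt0 //.
apply: lt_le_trans em _; rewrite -[leRHS]/(2 ^+ n) -natrX ler_nat.
by apply: leq_trans mn (ltnW (ltn_expl _ _)).
Qed.

(** * Convergents of a continued fraction *)

Section Convergents.
Variable K : fieldType.
Implicit Types (a : nat -> {poly K}) (n m k : nat).

(** Numerators and denominators of convergents obey one recurrence and differ
    only in their first two values x and y. *)
Fixpoint continuant a (x y : {poly K}) n : {poly K} :=
  if n is n'.+1 then
    if n' is n''.+1 then a n * continuant a x y n' + continuant a x y n''
    else y
  else x.
Arguments continuant a x y !n : simpl nomatch.

Definition cnum a := continuant a (a 0) (a 0 * a 1 + 1).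
Definition cden a := continuant a 1 (a 1).

Lemma cnumSS a n : cnum a n.+2 = a n.+2 * cnum a n.+1 + cnum a n.
Proof. by []. Qed.
Lemma cdenSS a n : cden a n.+2 = a n.+2 * cden a n.+1 + cden a n.
Proof. by []. Qed.

Lemma cdenS a n : cden a n.+1 = cnum (fun i => a i.+1) n.
Proof.
suff [] : cden a n.+1 = cnum (fun i => a i.+1) n /\
          cden a n.+2 = cnum (fun i => a i.+1) n.+1 by [].
elim: n => [|n [IH1 IH2]].
  by split=> //=; rewrite cdenSS /cden /cnum /= mulrC.
by split=> //; rewrite cdenSS IH1 IH2 cnumSS.
Qed.

Lemma cnumS a n : cnum a n.+1 =
  a 0%N * cnum (fun i => a i.+1) n + cden (fun i => a i.+1) n.
Proof.
pose P n := cnum a n.+1 =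
  a 0%N * cnum (fun i => a i.+1) n + cden (fun i => a i.+1) n.
suff [] : P n /\ P n.+1 by [].
rewrite /P; elim: n => [|n [IH1 IH2]].
  by split=> //; rewrite cnumSS /cnum /cden /=; ring.
by split=> //; rewrite cnumSS IH1 IH2 [in RHS]cnumSS [in RHS]cdenSS; ring.
Qed.

Lemma cnum_cden_det a n :
  cnum a n.+1 * cden a n - cnum a n * cden a n.+1 = (-1) ^+ n.
Proof.
elim: n => [|n IH]; first by rewrite /cnum /cden /=; ring.
by rewrite cnumSS cdenSS exprS -IH; ring.
Qed.

Lemma size_cden a : (forall n, (1 <= n)%N -> (1 < size (a n))%N) ->
  forall n, (0 < size (cden a n) < size (cden a n.+1))%N.
Proof.
move=> a1; elim=> [|n /andP[IH0 IH1]]; first by rewrite /cden /= size_poly1 a1.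
have Hd : (0 < size (cden a n.+1))%N by lia.
have Ha := a1 n.+2 isT.
have Hs : size (a n.+2 * cden a n.+1) =
          (size (a n.+2) + size (cden a n.+1)).-1.
  by rewrite size_mul // -size_poly_gt0 // ltnW.
rewrite cdenSS size_polyDl Hs; move: IH0 IH1 Hd Ha;
  by move: (size (cden a n)) (size (cden a n.+1)) (size (a n.+2)) => *; lia.
Qed.

(** [cfrac] unfolds from the left while the recurrence runs from the right; the
    two are related through the shifted sequence, so that the nonvanishing of
    the denominators has to be known for every shift. *)
Lemma cfracE a n : (forall m, cden a m != 0) ->
  (forall m k, cden (fun i => a (i + k)%N) m != 0) ->
  cfrac a n = lpoly (cnum a n) / lpoly (cden a n).
Proof.
elim: n a => [|n IH] a Ha Hak; first by rewrite /= rmorph1 divr1.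
rewrite [LHS]/= IH; first last.
- move=> m k; have -> : (fun i => a (i + k).+1) = (fun i => a (i + k.+1)%N).
    by apply: boolp.funext => i; rewrite addnS.
  exact: Hak.
- move=> m; have := Hak m 1%N.
  by have -> : (fun i => a i.+1) = (fun i => a (i + 1)%N)
    by apply: boolp.funext => i; rewrite addn1.
rewrite invf_div cdenS cnumS -cdenS rmorphD rmorphM.
by rewrite mulrDl mulfK // lpoly_eq0.
Qed.

End Convergents.

(** * Convergence from infinitely many good approximations *)

Section Convergence.
Variables (K : fieldType) (a : nat -> {poly K}) (f : laurent K).
Hypothesis a_nonconst : forall n, (1 <= n)%N -> (1 < size (a n))%N.
Hypothesis approx : forall n, exists2 m, (n <= m)%N &
  lbound (lpoly (cden a m) * f - lpoly (cnum a m)) (-1).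

Let d n : int := (size (cden a n))%:Z - 1.

Lemma cden_neq0 n : cden a n != 0.
Proof. by rewrite -size_poly_gt0; have /andP[] := size_cden a_nonconst n. Qed.

Let lq0 n : lpoly (cden a n) != 0.
Proof. by rewrite lpoly_eq0 cden_neq0. Qed.

Let ltd n : d n < d n.+1.
Proof.
rewrite /d; have /andP[_] := size_cden a_nonconst n.
by move: (size (cden a n)) (size (cden a n.+1)) => *; lia.
Qed.

Let led n m : (n <= m)%N -> d n <= d m.
Proof.
elim: m => [|m IH]; first by rewrite leqn0 => /eqP->.
by rewrite leq_eqVlt => /orP[/eqP->//|/IH/le_trans]; apply; apply/ltW/ltd.
Qed.

Let led_n n : n%:Z <= d n.
Proof.
elim: n => [|n IH]; first by rewrite /d /cden /= size_poly1.
by have := ltd n; lia.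
Qed.

Let cvt n := lpoly (cnum a n) / lpoly (cden a n).

Let cvt_step n : lbound (cvt n.+1 - cvt n) (- (d n + d n.+1)).
Proof.
have -> : cvt n.+1 - cvt n =
    lpoly ((-1) ^+ n) * ((lpoly (cden a n))^-1 * (lpoly (cden a n.+1))^-1).
  rewrite -(cnum_cden_det a) rmorphB !rmorphM /cvt.
  by field; rewrite !lq0.
have -> : - (d n + d n.+1) =
    ((size ((-1) ^+ n : {poly K}))%:Z - 1) + (- d n + - d n.+1).
  by rewrite -[(-1) ^+ n]mulr1 size_Msign size_poly1; lia.
apply: lboundM; first exact: lbound_lpoly.
by apply: lboundM; rewrite opprB; apply: lbound_lpolyV; apply: cden_neq0.
Qed.

Let cvt_dist n m : (n <= m)%N -> lbound (cvt m - cvt n) (- (d n + d n.+1)).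
Proof.
elim: m => [|m IH]; first by rewrite leqn0 => /eqP->; rewrite subrr.
rewrite leq_eqVlt => /orP[/eqP->|nm]; first by rewrite subrr.
have -> : cvt m.+1 - cvt n = (cvt m.+1 - cvt m) + (cvt m - cvt n) by ring.
apply: lboundD; last exact: IH.
apply: lboundW (@cvt_step m).
by have := led nm; have := led (nm : (n <= m)%N); lia.
Qed.

(** Compare with a convergent of large index m for which [approx] holds: its
    distance to f is below any prescribed bound, and its distance to the n-th
    convergent is at most the bound for that between the n-th one and its
    successor. *)
Lemma cvt_error n : lbound (cvt n - f) (- (d n + d n.+1)).
Proof.
have [m nm fm] := approx (n + `|d n + d n.+1|).
have -> : cvt n - f = (cvt m - f) - (cvt m - cvt n) by ring.
apply: lboundB; last by apply: cvt_dist; lia.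
have -> : cvt m - f =
    - ((lpoly (cden a m) * f - lpoly (cnum a m)) * (lpoly (cden a m))^-1).
  by rewrite /cvt; field; apply: lq0.
apply/lboundN/(@lboundW _ _ (-1 + (1 - (size (cden a m))%:Z))).
  by rewrite -[1 - _]opprB -/(d m); have := led_n m; lia.
by apply: lboundM => //; apply/lbound_lpolyV/cden_neq0.
Qed.

Lemma linear_form_bound n :
  lbound (lpoly (cden a n) * f - lpoly (cnum a n)) (- d n.+1).
Proof.
have -> : lpoly (cden a n) * f - lpoly (cnum a n) =
    - (lpoly (cden a n) * (cvt n - f)).
  by rewrite /cvt; field; apply: lq0.
apply: lboundN; have -> : - d n.+1 = d n + - (d n + d n.+1) by ring.
by apply: lboundM; [exact: lbound_lpoly|exact: cvt_error].
Qed.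

(** If f = P/Q, then Q (q_n f - p_n) is a polynomial of negative degree once
    n is large, so f equals two consecutive convergents, against the
    determinant identity. *)
Lemma cvt_not_ratfun : ~ is_ratfun f.
Proof.
move=> [P [Q [Q0 fE]]]; have lQ0 : lpoly Q != 0 by rewrite lpoly_eq0.
have exact_cvt n : (size Q <= n)%N -> cden a n * P = cnum a n * Q.
  move=> Qn; apply/eqP; rewrite -subr_eq0; apply/eqP/lpoly_lbound_eq0.
  have -> : lpoly (cden a n * P - cnum a n * Q) =
      lpoly Q * (lpoly (cden a n) * f - lpoly (cnum a n)).
    by rewrite rmorphB !rmorphM fE; field.
  apply: (@lboundW _ _ ((size Q)%:Z - 1 + - d n.+1)).
    have := led_n n.+1; move: Qn; move: (d n.+1) (size Q) => *; lia.
  by apply: lboundM; [exact: lbound_lpoly|exact: linear_form_bound].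
set n := size Q; have E1 := exact_cvt n (leqnn n).
have E2 := exact_cvt n.+1 (leqnSn n).
have : (-1) ^+ n * Q = 0.
  rewrite -(cnum_cden_det a) mulrBl.
  have -> : cnum a n.+1 * cden a n * Q = cden a n * (cden a n.+1 * P).
    by rewrite E2; ring.
  have -> : cnum a n * cden a n.+1 * Q = cden a n.+1 * (cden a n * P).
    by rewrite E1; ring.
  by ring.
by move/eqP; rewrite mulf_eq0 signr_eq0 (negPf Q0).
Qed.

Lemma cfrac_cvt n : cfrac a n = cvt n.
Proof.
apply: cfracE => [|m k]; first exact: cden_neq0.
rewrite -size_poly_gt0.
have ak i : (1 <= i)%N -> (1 < size (a (i + k)%N))%N.
  by move=> i1; apply: a_nonconst; lia.
by have /andP[] := size_cden ak m.
Qed.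

Lemma cfrac_expansion : is_cfrac_expansion a f.
Proof.
split=> //; apply: lcvg_lbound => n; rewrite cfrac_cvt.
by apply: lboundW (@cvt_error n); have := led_n n; have := led_n n.+1; lia.
Qed.

End Convergence.

(** * The word and its polynomials *)

(** The first letter is the leading coefficient. *)
Fixpoint wpoly (v : seq nat) : {poly rat} :=
  if v is c :: v' then 'X^(size v') *+ c + wpoly v' else 0.

Lemma wpoly_cat v1 v2 : wpoly (v1 ++ v2) = 'X^(size v2) * wpoly v1 + wpoly v2.
Proof.
elim: v1 => [|c v1 IH] /=; first by rewrite mulr0 add0r.
by rewrite IH size_cat exprD mulrDr mulrnAr mulrC -addrA [_ * 'X^_]mulrC.
Qed.

Lemma coef_wpoly v k :
  (wpoly v)`_k = if (k < size v)%N then (nth 0%N v (size v - k.+1))%:R else 0.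
Proof.
elim: v => [|c v IH] /=; first by rewrite coef0.
rewrite coefD coefMn coefXn IH ltnS subSS.
case: (ltngtP k (size v)) => [kv|kv|->].
- by rewrite mul0rn add0r; have -> : (size v - k = (size v - k.+1).+1)%N by lia.
- by rewrite mul0rn add0r.
- by rewrite subnn addr0.
Qed.

Lemma theta_bound : lbound theta (-1).
Proof. by case. Qed.

Lemma theta_prefix (v : seq nat) m : prefix v (word m) ->
  lbound (lpoly 'X^(size v) * theta - lpoly (wpoly v)) (-1).
Proof.
move=> /prefixP[v' vE]; case=> [k|//] _.
rewrite lcoefB lpolyXnM [X in _ - X]/= coef_wpoly.
have sv : (size v <= ell m)%N by rewrite -size_word vE size_cat leq_addr.
case: ltnP => kv; last first.
  by have -> : k%:Z - (size v)%:Z = (k - size v)%:Z by lia; rewrite /= subr0.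
have -> : k%:Z - (size v)%:Z = Negz (size v - k.+1) by lia.
rewrite [X in X - _]/= (@w_word m) /=; last by lia.
by rewrite vE nth_cat ifT ?subrr //; lia.
Qed.

Definition word2 n := rcons (word n) 2%N.

Lemma size_word2 n : size (word2 n) = (ell n).+1.
Proof. by rewrite size_rcons size_word. Qed.

Lemma word2SS n : word2 n.+2 = word2 n.+1 ++ word2 n ++ word2 n.+1.
Proof. by rewrite /word2 wordSS !rcons_cat /= !cat_rcons rcons_cat. Qed.

Lemma prefix_word2 n : prefix (word2 n.+1 ++ word2 n) (word n.+2).
Proof.
apply/prefixP; exists (word n.+1).
by rewrite -catA /word2 !cat_rcons wordSS.
Qed.

Definition X2 n := wpoly (word2 n).

Lemma X2SS n : X2 n.+2 =
  'X^((ell n).+1) * 'X^((ell n.+1).+1) * X2 n.+1 +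
    'X^((ell n.+1).+1) * X2 n + X2 n.+1.
Proof. by rewrite /X2 word2SS !wpoly_cat size_cat !size_word2 exprD addrA. Qed.

(** The exponent e_(n+1), the halving being exact by [odd_ell]. *)
Definition mid n := ((ell n.+1 + ell n + 3) %/ 2)%N.

Lemma mid_double n : (2 * mid n = ell n.+1 + ell n + 3)%N.
Proof. by have := odd_ell (ltn0Sn n); rewrite /mid /=; lia. Qed.

Lemma mid_pred n : mid n = (mid n).-1.+1.
Proof. by have := mid_double n; lia. Qed.

Lemma midS n : (mid n.+1 = mid n + (ell n.+1).+1)%N.
Proof.
by have := mid_double n; have := mid_double n.+1; rewrite ellSS; lia.
Qed.

Section Powers.
Variable n : nat.
Local Notation u := ('X^((ell n.+1).+1) : {poly rat}).
Local Notation v := ('X^((ell n).+1) : {poly rat}).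
Local Notation g := ('X^((mid n).-1) : {poly rat}).

Lemma Xell_mul : v * u = 'X * g * g.
Proof.
rewrite -exprD -[X in X * g * g]expr1 -!exprD; congr ('X^_).
by have := mid_double n; lia.
Qed.

Lemma Xmid : 'X^(mid n) = 'X * g :> {poly rat}.
Proof. by rewrite {1}mid_pred exprS. Qed.

Lemma Xmid_predS : 'X^((mid n.+1).-1) = u * g :> {poly rat}.
Proof.
by rewrite -exprD; congr ('X^_); have := mid_pred n; rewrite midS; lia.
Qed.

Lemma XmidS : 'X^(mid n.+1) = 'X * g * u :> {poly rat}.
Proof. by rewrite midS exprD Xmid. Qed.

Lemma XellSS : 'X^((ell n.+2).+1) = u * u * v :> {poly rat}.
Proof. by rewrite -!exprD; congr ('X^_); rewrite ellSS; lia. Qed.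

End Powers.

(** With x_(n+2) = x_(n+1) x_n x_(n+1), the words x_(n+2) x_(n+1) and
    x_(n+1) x_(n+2) have x_(n+1) as a common prefix and a common suffix, and
    between them x_n x_(n+1) and x_(n+1) x_n: going from n to n+1 multiplies
    the difference by - T^(L_(n+1)). *)
Lemma X2_commutator n :
  X2 n.+1 * ('X^((ell n).+1) - 1) - X2 n * ('X^((ell n.+1).+1) - 1) =
    (-1) ^+ n.+1 * 'X^((mid n).-1) * ('X - 1).
Proof.
elim: n => [|n IH]; first by rewrite /X2 /=; ring.
rewrite XellSS Xmid_predS [(-1) ^+ _]exprS.
transitivity (- 'X^((ell n.+1).+1) *
    ((-1) ^+ n.+1 * 'X^((mid n).-1) * ('X - 1)) : {poly rat}); last by ring.
by rewrite -IH X2SS; ring.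
Qed.

(** * The two-step recurrence of the even convergents *)

(** Up to scalars, these are the numerators and denominators of the convergents
    of index 4n+2 for n >= 1 (C) and of index 4n+4 for n >= 0 (D). *)
Definition Cnum n := 'X^((ell n).+1) * X2 n.+1 + X2 n.
Definition Cden n : {poly rat} := 'X^((ell n).+1) * 'X^((ell n.+1).+1) - 1.
Definition Dnum n := 'X^(mid n) * X2 n.+1 - (-1) ^+ n.+1 * ('X - 1).
Definition Dden n : {poly rat} := 'X^(mid n.+1) - 'X^(mid n).

Definition even_recurrence (C D : nat -> {poly rat}) n :=
  C n.+1 = ('X^((mid n.+1).-1) + 'X^((mid n).-1)) * D n + C n /\
  D n.+1 = 'X^(mid n) * C n.+1 - D n.

Lemma num_recurrence n : even_recurrence Cnum Dnum n.
Proof.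
split; last by rewrite /Dnum /Cnum XmidS Xmid [(-1) ^+ n.+2]exprS; ring.
rewrite /Cnum /Dnum X2SS Xmid_predS Xmid.
have H1 := Xell_mul n; have H2 := X2_commutator n.
move: H1 H2; set v := 'X^((ell n).+1); set u := 'X^((ell n.+1).+1).
set g := 'X^((mid n).-1); set x1 := X2 n.+1; set x0 := X2 n.
move=> H1 H2; apply/eqP; rewrite -subr_eq0; apply/eqP.
(* The difference of the two sides is the factor u + 1 times a combination of
   the two relations H1 and H2. *)
transitivity ((u + 1) * (x1 * (v * u - 'X * g * g)
   - (x1 * (v - 1) - x0 * (u - 1) - (-1) ^+ n.+1 * g * ('X - 1)))).
  by ring.
by rewrite H1 H2 !subrr mulr0 subrr mulr0.
Qed.

Lemma den_recurrence n : even_recurrence Cden Dden n.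
Proof.
have H := Xell_mul n; split; rewrite /Cden /Dden.
  rewrite XellSS Xmid_predS XmidS Xmid.
  move: H; set v := 'X^((ell n).+1); set u := 'X^((ell n.+1).+1).
  set g := 'X^((mid n).-1) => H.
  have -> : u * (u * u * v) = u * u * (v * u) by ring.
  by rewrite H; ring.
rewrite [in 'X^(mid n.+2)]midS exprD XellSS XmidS Xmid.
move: H; set v := 'X^((ell n).+1); set u := 'X^((ell n.+1).+1).
set g := 'X^((mid n).-1) => H.
have -> : u * (u * u * v) = u * u * (v * u) by ring.
have -> : 'X * g * u * (u * u * v) = 'X * g * u * u * (v * u) by ring.
by rewrite H; ring.
Qed.

(** * The partial quotients *)

Lemma leq_ellS n : (ell n <= ell n.+1)%N.
Proof. by case: n => // n; rewrite ellSS; lia. Qed.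

Lemma r_gt0 n : 0 < r n.+1.
Proof.
have le_ell : (ell n)%:R <= (ell n.+1)%:R :> rat by rewrite ler_nat leq_ellS.
have ell_ge0 : 0 <= (ell n.+1)%:R :> rat by rewrite ler0n.
rewrite /r succnK; move: le_ell ell_ge0.
by move: (ell n)%:R (ell n.+1)%:R => x y *; lra.
Qed.

(** Since r_n is a multiple of 2 L_n - L_(n-1), it inherits the recurrence of
    the lengths L_n. *)
Lemma rSS n : r n.+3 = 2 * r n.+2 + r n.+1.
Proof.
have natr_ellSS m : (ell m.+2)%:R = 2 * (ell m.+1)%:R + (ell m)%:R + 2 :> rat.
  by rewrite ellSS 2!natrD (natrM _ 2).
by rewrite /r !succnK !natr_ellSS; ring.
Qed.

Lemma s_gt0 n : 0 < s n.+1.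
Proof. by rewrite /s addr_gt0 ?r_gt0. Qed.

Lemma sE n : s n = r n.+1 + r n.
Proof. by []. Qed.

Definition quot_tail n j : {poly rat} :=
  nth 0 [:: ((-1) ^+ n.+1 * r n ^+ 2) *: A n;
            ((-1) ^+ n.+1 * (r n * s n)^-1) *: ('X - 1);
            ((-1) ^+ n.+1 * s n ^+ 2) *: B n;
            ((-1) ^+ n.+1 * (r n.+1 * s n)^-1) *: ('X - 1)] j.

Definition quot (k : nat) : {poly rat} :=
  if k is k'.+1 then
    if (k' < 4)%N then
      nth 0 [:: 'X - 2%:P; (1 / 2) *: 'X + (1 / 4)%:P;
                (8 / 5) *: 'X + (76 / 25)%:P;
                (- (125 / 48)) *: 'X + (25 / 24)%:P] k'
    else quot_tail (k' %/ 4) (k' %% 4)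
  else 0.

(** * The first four convergents *)

(** Explicit low-degree convergents are compared coefficientwise, which reduces
    every identity to arithmetic in the field of rationals. *)
Definition quartic (c4 c3 c2 c1 c0 : rat) : {poly rat} :=
  c4%:P * 'X^4 + c3%:P * 'X^3 + c2%:P * 'X^2 + c1%:P * 'X + c0%:P.

Lemma quartic_step a b c3 c2 c1 c0 d4 d3 d2 d1 d0 :
  (a *: 'X + b%:P) * quartic 0 c3 c2 c1 c0 + quartic d4 d3 d2 d1 d0 =
  quartic (a * c3 + d4) (a * c2 + b * c3 + d3) (a * c1 + b * c2 + d2)
    (a * c0 + b * c1 + d1) (b * c0 + d0).
Proof. by rewrite /quartic -mul_polyC; ring. Qed.

Lemma quartic_scale c c4 c3 c2 c1 c0 :
  c%:P * quartic c4 c3 c2 c1 c0 =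
  quartic (c * c4) (c * c3) (c * c2) (c * c1) (c * c0).
Proof. by rewrite /quartic; ring. Qed.

Lemma quartic_sub c4 c3 c2 c1 c0 d4 d3 d2 d1 d0 :
  quartic c4 c3 c2 c1 c0 - quartic d4 d3 d2 d1 d0 =
  quartic (c4 - d4) (c3 - d3) (c2 - d2) (c1 - d1) (c0 - d0).
Proof. by rewrite /quartic; ring. Qed.

Lemma quartic0 : quartic 0 0 0 0 0 = 0.
Proof. by rewrite /quartic; ring. Qed.

Lemma quot1E : quot 1 = 1 *: 'X + (-2)%:P.
Proof. by rewrite /quot /= scale1r polyCN. Qed.

Lemma XsubC1E : 'X - 1 = 1 *: 'X + (-1)%:P :> {poly rat}.
Proof. by rewrite scale1r polyCN. Qed.

Lemma quot2E : quot 2 = (1 / 2) *: 'X + (1 / 4)%:P.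
Proof. by []. Qed.

Lemma quot3E : quot 3 = (8 / 5) *: 'X + (76 / 25)%:P.
Proof. by []. Qed.

Lemma quot4E : quot 4 = (- (125 / 48)) *: 'X + (25 / 24)%:P.
Proof. by []. Qed.

Lemma r1E : r 1 = 12 / 25.
Proof. by []. Qed.

Lemma r2E : r 2 = 32 / 25.
Proof. by []. Qed.

(** The induction hypothesis on a solution z of the recurrence at the start of
    a block; at n = 0 it involves only the first four partial quotients. *)
Definition block_state (z C D : nat -> {poly rat}) n :=
  ('X - 1) * z (4 * n + 3)%N =
    - (-1) ^+ n * ((r n.+1)%:P * C n - ((r n.+2)%:P - (r n.+1)%:P) * D n) /\
  z (4 * n + 3).+1 = - (r n.+1)^-1%:P * D n.

Lemma cden_base : block_state (cden quot) Cden Dden 0.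
Proof.
have z0 : cden quot 0 = quartic 0 0 0 0 1.
  by rewrite /cden /quartic /= !polyC0; ring.
have z1 : cden quot 1 = quartic 0 0 0 1 (-2).
  by rewrite /quartic [LHS]quot1E -mul_polyC; ring.
have z2 : cden quot 2 = quartic 0 0 (1 / 2) (- (3 / 4)) (1 / 2).
  by rewrite cdenSS z0 z1 quot2E quartic_step; congr quartic; field.
have z3 : cden quot 3 = quartic 0 (4 / 5) (8 / 25) (- (12 / 25)) (- (12 / 25)).
  by rewrite cdenSS z2 z1 quot3E quartic_step; congr quartic; field.
have C0 : Cden 0 = quartic 0 1 0 0 (-1).
  by rewrite /Cden /quartic /=; ring.
have D0 : Dden 0 = quartic 1 0 (-1) 0 0.
  by rewrite /Dden /quartic /=; ring.
rewrite /block_state muln0 add0n C0 D0 r1E r2E; split.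
  rewrite XsubC1E z3 expr0 -polyC1 -polyCN -polyCB !quartic_scale.
  rewrite quartic_sub quartic_scale.
  rewrite -[LHS]addr0 -[X in _ + X = _]quartic0 quartic_step.
  by congr quartic; field.
rewrite cdenSS z3 z2 quot4E quartic_step -polyCN quartic_scale.
by congr quartic; field.
Qed.

Lemma cnum_base : block_state (cnum quot) Cnum Dnum 0.
Proof.
have z1 : cnum quot 1 = quartic 0 0 0 0 1.
  by rewrite /cnum /quartic /= mul0r; ring.
have z2 : cnum quot 2 = quartic 0 0 0 (1 / 2) (1 / 4).
  have z0 : cnum quot 0 = quartic 0 0 0 0 0 by rewrite /cnum /quartic /=; ring.
  by rewrite cnumSS z0 z1 quot2E quartic_step; congr quartic; field.
have z3 : cnum quot 3 = quartic 0 0 (4 / 5) (48 / 25) (44 / 25).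
  by rewrite cnumSS z2 z1 quot3E quartic_step; congr quartic; field.
have C0 : Cnum 0 = quartic 0 0 1 2 2.
  by rewrite /Cnum /X2 /quartic /=; ring.
have D0 : Dnum 0 = quartic 0 1 2 1 (-1).
  by rewrite /Dnum /X2 /quartic /=; ring.
rewrite /block_state muln0 add0n C0 D0 r1E r2E; split.
  rewrite XsubC1E z3 expr0 -polyC1 -polyCN -polyCB !quartic_scale.
  rewrite quartic_sub quartic_scale.
  rewrite -[LHS]addr0 -[X in _ + X = _]quartic0 quartic_step.
  by congr quartic; field.
rewrite cnumSS z3 z2 quot4E quartic_step -polyCN quartic_scale.
by congr quartic; field.
Qed.

(** * Degrees of the partial quotients *)

Local Opaque r s A B ell.

Lemma quot_block n j : (j < 4)%N -> quot (4 * n.+1 + j.+1) = quot_tail n.+1 j.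
Proof.
move=> j4; rewrite addnS /quot ifF; last by lia.
by rewrite [(4 * _)%N]mulnC divnMDl // divn_small // addn0 modnMDl modn_small.
Qed.

Lemma size_XsubC1 : size ('X - 1 : {poly rat}) = 2%N.
Proof. exact: size_XsubC. Qed.

Lemma A_exactS n :
  A n.+1 * ('X - 1) = 'X^((mid n.+1).-1) + 'X^((mid n).-1) - 2.
Proof.
rewrite A_exact succnK; congr ('X^_ + 'X^_ - _).
  by have := mid_double n; rewrite midS; lia.
by have := mid_double n; lia.
Qed.

Lemma B_exactS n : B n.+1 * ('X - 1) = 'X^(mid n) - 1.
Proof. by rewrite B_exact. Qed.

Lemma size_quot k : (1 <= k)%N -> (1 < size (quot k))%N.
Proof.
have XsC1_neq0 : 'X - 1 != 0 :> {poly rat} by rewrite polyXsubC_eq0.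
have size_div (p q : {poly rat}) : p * ('X - 1) = q -> (2 < size q)%N ->
    (1 < size p)%N.
  move=> <-; have [->|p0] := eqVneq p 0; first by rewrite mul0r size_poly0.
  by rewrite size_mul // size_XsubC1; move: (size p) => m; lia.
have linear (a b : rat) : a != 0 -> (1 < size (a *: 'X + b%:P)%R)%N.
  move=> a0; rewrite size_polyDl size_scale // size_polyX //.
  by rewrite size_polyC; case: (b != 0).
case: k => // k _; have [k4|k4] := ltnP k 4.
  rewrite /quot k4; case: k k4 => [|[|[|[|k]]]] //= _; try exact: linear.
  by rewrite size_XsubC.
pose n := (k %/ 4).-1.
have -> : k.+1 = (4 * n.+1 + (k %% 4).+1)%N by rewrite /n; lia.
have j4 : (k %% 4 < 4)%N by rewrite ltn_mod.
have sgn_neq0 (c : rat) : c != 0 -> (-1) ^+ n.+2 * c != 0.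
  by move=> c0; rewrite mulf_neq0 ?signr_eq0.
have [rn rn1 sn] : [/\ r n.+1 != 0, r n.+2 != 0 & s n.+1 != 0].
  by split; apply: lt0r_neq0; [exact: r_gt0|exact: r_gt0|exact: s_gt0].
have e0 := mid_double n; have e1 := midS n; have l1 := leq_ell n.+1.
rewrite (quot_block _ j4) /quot_tail.
move: (r n.+1) (r n.+2) (s n.+1) rn rn1 sn => r1 r2 s1 r1n r2n s1n.
move: (k %% 4)%N j4 => [|[|[|[|j]]]] //= _.
- rewrite size_scale ?sgn_neq0 ?expf_neq0 //.
  apply: (size_div _ _ (A_exactS n)).
  rewrite -addrA size_polyDl size_polyXn; first by lia.
  apply: leq_ltn_trans (size_polyD _ _) _.
  rewrite size_polyXn size_polyN gtn_max -[2]/(2%:R) -polyC_natr size_polyC.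
  by lia.
- by rewrite size_scale ?size_XsubC1 ?sgn_neq0 ?invr_eq0 ?mulf_neq0.
- rewrite size_scale ?sgn_neq0 ?expf_neq0 //.
  apply: (size_div _ _ (B_exactS n)).
  rewrite size_polyDl ?size_polyXn ?size_polyN ?size_poly1; lia.
- by rewrite size_scale ?size_XsubC1 ?sgn_neq0 ?invr_eq0 ?mulf_neq0.
Qed.

(** * Four steps of the continued fraction *)

(** The recurrence for z with one block of partial quotients.  The even-indexed
    quotients are multiples of x = T - 1, so the odd-indexed terms, here z0, z2
    and z4, are needed only in the form x z0, x z2 and x z4; multiplying a and
    b by x produces the multipliers of the two identities for C and D.
    [r1V], [r2V] and [s1V] stand for inverses. *)
Lemma block_step (R : comNzRingType)
    (x eps r1 r1V s1 s1V r2 r2V a b C0 D0 C1 D1 z0 z1 z2 z3 z4 z5 : R) :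
  eps * eps = 1 -> r1 * r1V = 1 -> r2 * r2V = 1 -> s1 * s1V = 1 ->
  s1 = r2 + r1 ->
  C1 = (a * x + 2) * D0 + C0 -> D1 = (b * x + 1) * C1 - D0 ->
  x * z0 = - eps * (r1 * C0 - (r2 - r1) * D0) -> z1 = - r1V * D0 ->
  z2 = eps * r1 ^+ 2 * a * z1 + z0 ->
  z3 = eps * (r1V * s1V) * x * z2 + z1 ->
  z4 = eps * s1 ^+ 2 * b * z3 + z2 ->
  z5 = eps * (r2V * s1V) * x * z4 + z3 ->
  [/\ z3 = - s1V * C1, x * z4 = eps * (r2 * C1 - s1 * D1) & z5 = - r2V * D1].
Proof.
move=> eps2 r1K r2K s1K s1E C1E D1E z0E z1E z2E z3E z4E z5E.
have xz2 : x * z2 = - eps * (r1 * C1 - s1 * D0).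
  rewrite z2E mulrDr z0E z1E C1E s1E.
  transitivity (- eps * r1 * (r1 * r1V) * (a * x) * D0
                - eps * (r1 * C0 - (r2 - r1) * D0)); first by ring.
  by rewrite r1K; ring.
have z3E' : z3 = - s1V * C1.
  rewrite z3E -[_ * x * z2]mulrA xz2 z1E.
  transitivity (- (eps * eps) * s1V * ((r1 * r1V) * C1) +
     (eps * eps) * r1V * (s1 * s1V) * D0 - r1V * D0); first by ring.
  by rewrite eps2 r1K s1K; ring.
have xz4 : x * z4 = eps * (r2 * C1 - s1 * D1).
  rewrite z4E mulrDr xz2 z3E' D1E.
  transitivity (- eps * s1 * (s1 * s1V) * (b * x) * C1
                - eps * (r1 * C1 - s1 * D0)); first by ring.
  by rewrite s1K s1E; ring.
split=> //; rewrite z5E -[_ * x * z4]mulrA xz4 z3E'.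
transitivity ((eps * eps) * s1V * ((r2 * r2V) * C1)
   - (eps * eps) * r2V * (s1 * s1V) * D1 - s1V * C1); first by ring.
by rewrite eps2 r2K s1K; ring.
Qed.

Lemma polyC_sign_scale n (c : rat) (p : {poly rat}) :
  ((-1) ^+ n.+2 * c) *: p = (-1) ^+ n * c%:P * p.
Proof. by rewrite -mul_polyC polyCM rmorphXn rmorphN rmorph1 !exprS; ring. Qed.

Lemma polyC_inv_gt0 (c : rat) : 0 < c -> c%:P * c^-1%:P = 1.
Proof. by move=> c0; rewrite -polyCM mulfV ?lt0r_neq0. Qed.

(** * The convergents of index 4n+2 *)

Section EvenConvergents.
Variables (z C D : nat -> {poly rat}).
Hypothesis zSS : forall n, z n.+2 = quot n.+2 * z n.+1 + z n.
Hypothesis CD : forall n, even_recurrence C D n.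

Let z_block n j k c p : (j < 4)%N -> k = (4 * n + j + 3)%N ->
  quot_tail n.+1 j = ((-1) ^+ n.+2 * c) *: p ->
  z k.+2 = (-1) ^+ n * c%:P * p * z k.+1 + z k.
Proof.
move=> j4 kE; rewrite -quot_block // polyC_sign_scale => <-.
by rewrite zSS; congr (quot _ * _ + _); lia.
Qed.

Let block n : block_state z C D n ->
  z (4 * n + 3).+3 = - (s n.+1)^-1%:P * C n.+1 /\ block_state z C D n.+1.
Proof.
move=> [h3 h4]; have [C1E D1E] := CD n.
have kE j : (4 * n + 3 + j = 4 * n + j + 3)%N by lia.
have z5 := @z_block n 0 _ _ _ isT (kE 0%N) erefl.
have z6 := @z_block n 1 _ _ _ isT (kE 1%N) erefl.
have z7 := @z_block n 2 _ _ _ isT (kE 2%N) erefl.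
have z8 := @z_block n 3 _ _ _ isT (kE 3%N) erefl.
have idx j : (4 * n + 3 + j = j + (4 * n + 3))%N by rewrite addnC.
rewrite !idx in z5 z6 z7 z8.
have eps2 : (-1) ^+ n * (-1) ^+ n = 1 :> {poly rat} by rewrite -expr2 sqrr_sign.
have s1E : (s n.+1)%:P = (r n.+2)%:P + (r n.+1)%:P by rewrite sE polyCD.
have s1E' : (s n.+1)%:P = (r n.+3)%:P - (r n.+2)%:P.
  rewrite -polyCB sE rSS; congr (_%:P).
  by move: (r n.+1) (r n.+2) => x y; ring.
have C1E' : C n.+1 = (A n.+1 * ('X - 1) + 2) * D n + C n.
  by rewrite A_exactS C1E; ring.
have D1E' : D n.+1 = (B n.+1 * ('X - 1) + 1) * C n.+1 - D n.
  by rewrite B_exactS D1E; ring.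
rewrite polyC_exp in z5; rewrite polyC_exp in z7.
rewrite invfM polyCM in z6; rewrite invfM polyCM in z8.
have [E6 E7 E8] := block_step eps2 (polyC_inv_gt0 (r_gt0 n))
  (polyC_inv_gt0 (r_gt0 n.+1)) (polyC_inv_gt0 (s_gt0 n)) s1E C1E' D1E'
  h3 h4 z5 z6 z7 z8.
split; first exact: E6.
rewrite /block_state -s1E' (_ : (4 * n.+1 + 3 = (4 * n + 3).+4)%N); last by lia.
by split; [rewrite E7 exprS mulN1r opprK|exact: E8].
Qed.

Hypothesis state0 : block_state z C D 0.

Lemma even_convergents n : z (4 * n + 3).+3 = - (s n.+1)^-1%:P * C n.+1.
Proof.
have st m : block_state z C D m by elim: m => // m /block[].
by have [] := block (st n).
Qed.

End EvenConvergents.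

Lemma cden_quot n :
  cden quot (4 * n + 3).+3 = - (s n.+1)^-1%:P * Cden n.+1.
Proof.
apply: even_convergents => [k|k|]; [exact: cdenSS|exact: den_recurrence|].
exact: cden_base.
Qed.

Lemma cnum_quot n :
  cnum quot (4 * n + 3).+3 = - (s n.+1)^-1%:P * Cnum n.+1.
Proof.
apply: even_convergents => [k|k|]; [exact: cnumSS|exact: num_recurrence|].
exact: cnum_base.
Qed.

Lemma quot_approx n : exists2 m, (n <= m)%N &
  lbound (lpoly (cden quot m) * theta - lpoly (cnum quot m)) (-1).
Proof.
exists (4 * n + 3).+3; first by lia.
rewrite cden_quot cnum_quot lpoly_formZ -[-1]add0r; apply: lboundM.
  apply: lboundW (@lbound_lpoly _ _); rewrite -polyCN.
  by rewrite size_polyC; case: (_ != 0).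
(* The denominator is T^N - 1; the term - theta has negative degree. *)
have -> : lpoly (Cden n.+1) * theta - lpoly (Cnum n.+1) =
    lpoly 'X^(size (word2 n.+2 ++ word2 n.+1)) * theta -
      lpoly (wpoly (word2 n.+2 ++ word2 n.+1)) - theta.
  rewrite wpoly_cat size_cat !size_word2 addnC exprD /Cden.
  by rewrite rmorphB rmorph1 mulrBl mul1r addrAC.
apply: lboundB; last exact: theta_bound.
exact/theta_prefix/prefix_word2.
Qed.

Theorem mainTheorem1 :
  ~ is_ratfun theta /\
  exists a : nat -> {poly rat},
    [/\ a 0%N = 0,
        is_cfrac_expansion a theta,
        [/\ a 1%N = 'X - 2%:P,
            a 2%N = (1 / 2) *: 'X + (1 / 4)%:P,
            a 3%N = (8 / 5) *: 'X + (76 / 25)%:P &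
            a 4%N = (- (125 / 48)) *: 'X + (25 / 24)%:P] &
        forall n : nat, (1 <= n)%N ->
          [/\ a (4 * n + 1)%N = ((-1) ^+ n.+1 * r n ^+ 2) *: A n,
              a (4 * n + 2)%N = ((-1) ^+ n.+1 * (r n * s n)^-1) *: ('X - 1),
              a (4 * n + 3)%N = ((-1) ^+ n.+1 * s n ^+ 2) *: B n &
              a (4 * n + 4)%N = ((-1) ^+ n.+1 * (r n.+1 * s n)^-1) *: ('X - 1)]].
Proof.
split; first exact: cvt_not_ratfun size_quot quot_approx.
exists quot; split=> //; first exact: cfrac_expansion size_quot quot_approx.
case=> [//|n _]; split.
- exact: (@quot_block n 0).
- exact: (@quot_block n 1).
- exact: (@quot_block n 2).
- exact: (@quot_block n 3).
Qed.
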